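(* Let $(\mathcal{C}_n)_{n\in\mathbb{N}}$ be a sequence of unital $C^*$-algebras, let $\mathcal{F}$ be their product, and let $\mathcal{A}$ be a separable $C^*$-subalgebra of $\mathcal{F}$. Then there exists a strictly increasing sequence $\eta:\mathbb{N}\to\mathbb{N}$ such that the restricted algebra $\mathcal{A}_\eta = R_\eta\mathcal{A}$ is a fractal subalgebra of $\mathcal{F}_\eta$.
   Context: Given a sequence $(\mathcal{C}_n)_{n\in\mathbb{N}}$ of unital $C^*$-algebras, $\mathcal{F}$ denotes the $C^*$-algebra of all bounded sequences $(A_n)$ with $A_n\in\mathcal{C}_n$ (pointwise operations, supremum norm), and $\mathcal{G}$ denotes its closed ideal of all sequences with $\|A_n\|\to 0$. For a strictly increasing $\eta:\mathbb{N}\to\mathbb{N}$, $\mathcal{F}_\eta$ is the product of the family $(\mathcal{C}_{\eta(n)})_{n\in\mathbb{N}}$, $\mathcal{G}_\eta$ is the ideal of sequences in $\mathcal{F}_\eta$ tending to zero in norm, and $R_\eta:\mathcal{F}\to\mathcal{F}_\eta$, $(A_n)\mapsto(A_{\eta(n)})$. For a $C^*$-subalgebra $\mathcal{A}$ of $\mathcal{F}$, $\mathcal{A}_\eta:=R_\eta(\mathcal{A})$. A $^*$-homomorphism $W$ from a $C^*$-subalgebra $\mathcal{A}$ of $\mathcal{F}$ into a $C^*$-algebra $\mathcal{B}$ is called fractal if for every strictly increasing $\eta:\mathbb{N}\to\mathbb{N}$ there is a mapping $W_\eta:\mathcal{A}_\eta\to\mathcal{B}$ with $W=W_\eta R_\eta|_{\mathcal{A}}$.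 A $C^*$-subalgebra $\mathcal{A}$ of $\mathcal{F}$ is called fractal if the canonical homomorphism $\mathcal{A}\to\mathcal{A}/(\mathcal{A}\cap\mathcal{G})$ is fractal. Fractality of a $C^*$-subalgebra of $\mathcal{F}_\eta$ is defined in the same way, with $(\mathcal{C}_{\eta(n)})_{n\in\mathbb{N}}$ and $\mathcal{G}_\eta$ in place of $(\mathcal{C}_n)_{n\in\mathbb{N}}$ and $\mathcal{G}$. *)

(* Defs.v *)
From HB Require Import structures.
From mathcomp Require Import all_boot all_order all_algebra ring.
From mathcomp Require Import complex.
From mathcomp Require Import all_classical all_reals all_analysis.

Set Implicit Arguments.
Unset Strict Implicit.
Unset Printing Implicit Defensive.

Import Order.TTheory GRing.Theory Num.Theory.
Import numFieldNormedType.Exports.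

Local Open Scope classical_set_scope.
Local Open Scope complex_scope.
Local Open Scope ring_scope.

Reserved Notation "x *c y" (at level 40, left associativity).

(* The product is a field of the mixin, and not the one of a ring structure:
   C*-algebras need not have a unit, and the library's hierarchy has no join of
   rings with normed modules. As for every normed module over R[i], the norm
   takes its values in R[i], where `0 <= z` means that z is real and
   nonnegative. *)
HB.mixin Record CompleteNormedModule_isCStarAlgebra (R : realType) A
    of CompleteNormedModule R[i] A := {
  cmul : A -> A -> A;
  star : A -> A;
  cmulA : associative cmul;
  cmulDl : left_distributive cmul +%R;
  cmulDr : right_distributive cmul +%R;
  cscalerAl : forall (c : R[i]) (x y : A), c *: cmul x y = cmul (c *: x) y;
  cscalerAr : forall (c : R[i]) (x y : A), c *: cmul x y = cmul x (c *: y);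
  starD : {morph star : x y / x + y};
  starZ : forall (c : R[i]) (x : A), star (c *: x) = c^*%C *: star x;
  starM : forall x y : A, star (cmul x y) = cmul (star y) (star x);
  starK : involutive star;
  ler_cnormM : forall x y : A, `|cmul x y| <= `|x| * `|y|;
  cstar_identity : forall x : A, `|cmul (star x) x| = `|x| ^+ 2
}.

#[short(type="cstarAlgType")]
HB.structure Definition CStarAlgebra (R : realType) :=
  { A of CompleteNormedModule R[i] A
       & CompleteNormedModule_isCStarAlgebra R A }.

Notation "x *c y" := (cmul x y) : ring_scope.

HB.mixin Record CStarAlgebra_isUnital (R : realType) A of CStarAlgebra R A := {
  cone : A;
  cmul1x : left_id cone (@cmul R A);
  cmulx1 : right_id cone (@cmul R A)
}.

#[short(type="unitalCstarAlgType")]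
HB.structure Definition UnitalCStarAlgebra (R : realType) :=
  { A of CStarAlgebra R A & CStarAlgebra_isUnital R A }.

Section RealNorm.
Variables (R : realType) (V : normedModType R[i]).

(* the norm as an element of R *)
Definition rnorm (x : V) : R := complex.Re `|x|.

Lemma rnormE (x : V) : (rnorm x)%:C = `|x|.
Proof. by rewrite /rnorm RRe_real// normr_real. Qed.

Lemma rnorm_ge0 (x : V) : 0 <= rnorm x.
Proof. by rewrite -ler0c rnormE. Qed.

Lemma rnorm_leE (x : V) (M : R) : (rnorm x <= M) = (`|x| <= M%:C).
Proof. by rewrite -lecR rnormE. Qed.

End RealNorm.

Lemma Re_normcM (R : realType) (c : R[i]) (M : R) :
  (complex.Re `|c| * M)%:C = `|c| * M%:C.
Proof.
have cE : (complex.Re `|c|)%:C = `|c| by rewrite RRe_real// normr_real.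
by rewrite -[in RHS]cE; exact: rmorphM.
Qed.

Section CStarSubalgebra.
Variables (R : realType) (A : cstarAlgType R).

(* norm-closed *-subalgebras; a unit of A need not belong to S *)
Record cstar_subalgebra (S : set A) : Prop := CStarSubalgebra {
  csub0 : S 0;
  csubD : forall x y, S x -> S y -> S (x + y);
  csubZ : forall (c : R[i]) x, S x -> S (c *: x);
  csubM : forall x y, S x -> S y -> S (x *c y);
  csub_star : forall x, S x -> S (star x);
  csub_closed : closed S
}.

End CStarSubalgebra.

Definition separable_set (T : topologicalType) (S : set T) : Prop :=
  exists D : set T, [/\ countable D, D `<=` S & S `<=` closure D].

Section BoundedProduct.
Variables (R : realType) (C : nat -> unitalCstarAlgType R).

Definition seq_bounded (a : forall n, C n) : Prop :=
  exists M : R, forall n, rnorm (a n) <= M.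

Record bprod := BProd { bseq :> forall n, C n ; bseqP : seq_bounded bseq }.

Lemma bprodP (a b : bprod) : (forall n, a n = b n) -> a = b.
Proof.
case: a b => [a Pa] [b Pb] /= ab; have {ab}E : a = b by exact: functional_extensionality_dep.
by subst b; congr BProd; exact: Prop_irrelevance.
Qed.

HB.instance Definition _ := gen_eqMixin bprod.
HB.instance Definition _ := gen_choiceMixin bprod.

Lemma seq_bounded0 : seq_bounded (fun n => 0 : C n).
Proof. by exists 0 => n; rewrite rnorm_leE normr0. Qed.

Lemma seq_boundedN (a : bprod) : seq_bounded (fun n => - a n).
Proof.
by case: (bseqP a) => M aM; exists M => n; rewrite rnorm_leE normrN -rnorm_leE.
Qed.

Lemma seq_boundedD (a b : bprod) : seq_bounded (fun n => a n + b n).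
Proof.
case: (bseqP a) => M aM; case: (bseqP b) => N bN; exists (M + N) => n.
rewrite rnorm_leE; apply: (le_trans (ler_normD _ _)).
by rewrite rmorphD/= lerD// -rnorm_leE.
Qed.

Lemma seq_boundedZ (c : R[i]) (a : bprod) : seq_bounded (fun n => c *: a n).
Proof.
case: (bseqP a) => M aM; exists (complex.Re `|c| * M) => n.
rewrite rnorm_leE normrZ Re_normcM.
by rewrite ler_wpM2l// -rnorm_leE.
Qed.

Lemma seq_boundedM (a b : bprod) : seq_bounded (fun n => a n *c b n).
Proof.
case: (bseqP a) => M aM; case: (bseqP b) => N bN; exists (M * N) => n.
rewrite rnorm_leE; apply: (le_trans (ler_cnormM _ _)).
by rewrite rmorphM/= ler_pM// -rnorm_leE.
Qed.

Lemma norm_star (A : cstarAlgType R) (x : A) : `|star x| = `|x|.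
Proof.
suff H (y : A) : `|y| <= `|star y|.
  by apply/eqP; rewrite eq_le H andbT -{2}(starK x) H.
have [->//|y0] := eqVneq y 0; first by rewrite normr0.
rewrite -(ler_pM2r (x := `|y|)) ?normr_gt0// -expr2 -cstar_identity.
exact: ler_cnormM.
Qed.

Lemma seq_bounded_star (a : bprod) : seq_bounded (fun n => star (a n)).
Proof.
case: (bseqP a) => M aM; exists M => n; rewrite rnorm_leE norm_star.
by have := aM n; rewrite rnorm_leE.
Qed.

Lemma norm_cone_le1 (A : unitalCstarAlgType R) : `|cone : A| <= 1.
Proof.
have [->|c0] := eqVneq (cone : A) 0; first by rewrite normr0.
rewrite -(ler_pM2l (x := `|cone : A|)) ?normr_gt0// mulr1.
by rewrite -expr2 -cstar_identity cmulx1 norm_star.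
Qed.

Lemma seq_bounded1 : seq_bounded (fun n => cone : C n).
Proof. by exists 1 => n; rewrite rnorm_leE norm_cone_le1. Qed.

Definition bprod0 := BProd seq_bounded0.
Definition bprodN a := BProd (seq_boundedN a).
Definition bprodD a b := BProd (seq_boundedD a b).
Definition bprodZ c a := BProd (seq_boundedZ c a).

Let addA : associative bprodD.
Proof. by move=> a b c; apply: bprodP => n /=; rewrite addrA. Qed.
Let addC : commutative bprodD.
Proof. by move=> a b; apply: bprodP => n /=; rewrite addrC. Qed.
Let add0 : left_id bprod0 bprodD.
Proof. by move=> a; apply: bprodP => n /=; rewrite add0r. Qed.
Let addN : left_inverse bprod0 bprodN bprodD.
Proof. by move=> a; apply: bprodP => n /=; rewrite addNr. Qed.

HB.instance Definition _ := GRing.isZmodule.Build bprod addA addC add0 addN.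

Let scaleA c d (a : bprod) : bprodZ c (bprodZ d a) = bprodZ (c * d) a.
Proof. by apply: bprodP => n /=; rewrite scalerA. Qed.
Let scale1 : left_id 1 bprodZ.
Proof. by move=> a; apply: bprodP => n /=; rewrite scale1r. Qed.
Let scaleDr : right_distributive bprodZ +%R.
Proof. by move=> c a b; apply: bprodP => n /=; rewrite scalerDr. Qed.
Let scaleDl (a : bprod) : {morph bprodZ^~ a : c d / c + d}.
Proof. by move=> c d; apply: bprodP => n /=; rewrite scalerDl. Qed.

HB.instance Definition _ :=
  GRing.Zmodule_isLmodule.Build R[i] bprod scaleA scale1 scaleDr scaleDl.

Definition supnorm (a : bprod) : R := sup (range (fun n => rnorm (a n))).

Lemma has_sup_rnorm (a : bprod) : has_sup (range (fun n => rnorm (a n))).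
Proof.
split; first by exists (rnorm (a 0%N)), 0%N.
by case: (bseqP a) => M aM; exists M => _ [n _ <-].
Qed.

Lemma rnorm_le_supnorm (a : bprod) n : rnorm (a n) <= supnorm a.
Proof. by apply: sup_upper_bound; [exact: has_sup_rnorm | exists n]. Qed.

Lemma supnorm_le (a : bprod) (M : R) :
  (forall n, rnorm (a n) <= M) -> supnorm a <= M.
Proof.
move=> aM; apply: ge_sup => [|_ [n _ <-]//].
by case: (has_sup_rnorm a).
Qed.

Let supnormD (a b : bprod) :
  (supnorm (a + b))%:C <= (supnorm a)%:C + (supnorm b)%:C.
Proof.
rewrite -rmorphD/= lecR; apply: supnorm_le => n; rewrite rnorm_leE.
apply: (le_trans (ler_normD _ _)); rewrite rmorphD/= -!rnormE.
by rewrite lerD// lecR rnorm_le_supnorm.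
Qed.

Let supnormZ (c : R[i]) (a : bprod) :
  (supnorm (c *: a))%:C = `|c| * (supnorm a)%:C.
Proof.
have zle (d : R[i]) b : (supnorm (d *: b))%:C <= `|d| * (supnorm b)%:C.
  rewrite -Re_normcM lecR.
  apply: supnorm_le => n; rewrite rnorm_leE normrZ Re_normcM.
  by rewrite ler_wpM2l// -rnorm_leE rnorm_le_supnorm.
apply/eqP; rewrite eq_le zle/=.
have [->|c0] := eqVneq c 0.
  by rewrite normr0 mul0r ler0c (le_trans (rnorm_ge0 _) (rnorm_le_supnorm _ 0%N)).
rewrite -ler_pdivlMl ?normr_gt0// -normfV.
by apply: le_trans (zle _ _); rewrite scalerA mulVf// scale1r.
Qed.

Let supnorm0 (a : bprod) : (supnorm a)%:C = 0 -> a = 0.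
Proof.
move=> /(congr1 (@complex.Re R))/= a0; apply: bprodP => n /=.
have an : rnorm (a n) <= 0 by rewrite -[leRHS]a0 rnorm_le_supnorm.
apply/eqP; rewrite -normr_eq0 -rnormE (_ : rnorm (a n) = 0)//.
by apply/eqP; rewrite eq_le an rnorm_ge0.
Qed.

HB.instance Definition _ := Lmodule_isNormed.Build R[i] bprod
  supnormD supnormZ supnorm0.

Lemma bprod_normE (a : bprod) :
  `|a| = (sup (range (fun n => rnorm (a n))))%:C.
Proof. by []. Qed.

Lemma bprod_rnormE (a : bprod) : rnorm a = sup (range (fun n => rnorm (a n))).
Proof. by []. Qed.

Lemma norm_le_bprod (a : bprod) n : `|a n| <= `|a|.
Proof. by rewrite bprod_normE -rnorm_leE rnorm_le_supnorm. Qed.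

Lemma bprod_norm_le (a : bprod) (M : R[i]) :
  (forall n, `|a n| <= M) -> `|a| <= M.
Proof.
move=> aM; have M0 : M \is Num.real.
  by rewrite realE (le_trans (normr_ge0 _) (aM 0%N)).
rewrite bprod_normE -(RRe_real M0) lecR; apply: supnorm_le => n.
rewrite rnorm_leE (RRe_real M0); exact: aM.
Qed.

Let bprod_complete (F : set_system bprod) :
  ProperFilter F -> cauchy F -> cvg F.
Proof.
move=> FF /cauchyP Fc.
have ballE (x a : bprod) (e : R[i]) n : ball x e a -> `|x n - a n| < e.
  by rewrite -ball_normE /=; apply: le_lt_trans; exact: (norm_le_bprod (x - a)).
have cvgn n : cvg ((fun a : bprod => a n) @ F).
  apply: cauchy_cvg; apply/cauchyP => e e0; have [x Fx] := Fc e e0.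
  exists (x n); rewrite -ball_normE; apply: (@filterS _ F _ (ball x e)) => // a xa.
  exact: (ballE _ _ _ n xa).
pose l n : C n := lim ((fun a : bprod => a n) @ F).
have xl (e : R[i]) (x : bprod) : 0 < e -> F (ball x e) ->
    forall n, `|x n - l n| <= e + e.
  move=> e0 Fx n.
  have /cvgrPdist_lt/(_ e e0) Fl : (fun a : bprod => a n) @ F --> l n by exact: cvgn.
  have [a [xa la]] := filter_ex (filterI Fx Fl).
  rewrite -(subrKA (a n)) (le_trans (ler_normD _ _))// lerD// ltW//.
    exact: ballE.
  by rewrite distrC.
have lb : seq_bounded l.
  have [x Fx] := Fc 1 ltr01; exists (rnorm x + 2) => n.
  rewrite rnorm_leE rmorphD/= -(subrK (x n) (l n)) addrC.
  rewrite (le_trans (ler_normD _ _))// rnormE lerD ?norm_le_bprod//.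
  by rewrite distrC (le_trans (xl _ _ ltr01 Fx n))// rmorphMn.
apply/cvg_ex; exists (BProd lb); apply/cvgrPdist_le => e e0.
have e3 : 0 < e / 3 by rewrite divr_gt0.
have [x Fx] := Fc _ e3; apply: (@filterS _ F _ (ball x (e / 3))) => // a xa.
apply: bprod_norm_le => n /=.
rewrite -(subrKA (x n)) (le_trans (ler_normD _ _))//.
have -> : e = (e / 3 + e / 3) + e / 3 by field.
apply: lerD; last by apply/ltW; exact: (ballE _ _ _ n xa).
by rewrite distrC; exact: (xl _ _ e3 Fx n).
Qed.

HB.instance Definition _ := Uniform_isComplete.Build bprod bprod_complete.

Definition bprodM a b := BProd (seq_boundedM a b).
Definition bprod_star a := BProd (seq_bounded_star a).
Definition bprod1 := BProd seq_bounded1.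

Let mulA : associative bprodM.
Proof. by move=> a b c; apply: bprodP => n /=; rewrite cmulA. Qed.
Let mulDl : left_distributive bprodM +%R.
Proof. by move=> a b c; apply: bprodP => n /=; rewrite cmulDl. Qed.
Let mulDr : right_distributive bprodM +%R.
Proof. by move=> a b c; apply: bprodP => n /=; rewrite cmulDr. Qed.
Let scaleAl (c : R[i]) (a b : bprod) :
  c *: bprodM a b = bprodM (c *: a) b.
Proof. by apply: bprodP => n /=; rewrite cscalerAl. Qed.
Let scaleAr (c : R[i]) (a b : bprod) :
  c *: bprodM a b = bprodM a (c *: b).
Proof. by apply: bprodP => n /=; rewrite cscalerAr. Qed.
Let bstarD : {morph bprod_star : a b / a + b}.
Proof. by move=> a b; apply: bprodP => n /=; rewrite starD. Qed.
Let bstarZ (c : R[i]) (a : bprod) :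
  bprod_star (c *: a) = c^*%C *: bprod_star a.
Proof. by apply: bprodP => n /=; rewrite starZ. Qed.
Let bstarM (a b : bprod) :
  bprod_star (bprodM a b) = bprodM (bprod_star b) (bprod_star a).
Proof. by apply: bprodP => n /=; rewrite starM. Qed.
Let bstarK : involutive bprod_star.
Proof. by move=> a; apply: bprodP => n /=; rewrite starK. Qed.
Let bnormM (a b : bprod) : `|bprodM a b| <= `|a| * `|b|.
Proof.
apply: bprod_norm_le => n /=; apply: (le_trans (ler_cnormM _ _)).
by rewrite ler_pM// norm_le_bprod.
Qed.
Let bcstar (a : bprod) : `|bprodM (bprod_star a) a| = `|a| ^+ 2.
Proof.
apply/eqP; rewrite eq_le; apply/andP; split.
  apply: bprod_norm_le => n /=; rewrite cstar_identity.
  by rewrite lerXn2r ?nnegrE// norm_le_bprod.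
set m := `|bprodM _ _|; have m0 : 0 <= m by exact: normr_ge0.
rewrite -(sqrtCK m) lerXn2r ?nnegrE ?sqrtC_ge0//.
apply: bprod_norm_le => n.
rewrite -(ler_pXn2r (n := 2))// ?nnegrE ?sqrtC_ge0// sqrtCK.
by rewrite -cstar_identity (norm_le_bprod (bprodM (bprod_star a) a)).
Qed.

HB.instance Definition _ := CompleteNormedModule_isCStarAlgebra.Build R bprod
  mulA mulDl mulDr scaleAl scaleAr bstarD bstarZ bstarM bstarK bnormM bcstar.

Let bmul1 : left_id bprod1 (@cmul R bprod).
Proof. by move=> a; apply: bprodP => n /=; rewrite cmul1x. Qed.
Let bmulx1 : right_id bprod1 (@cmul R bprod).
Proof. by move=> a; apply: bprodP => n /=; rewrite cmulx1. Qed.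

HB.instance Definition _ := CStarAlgebra_isUnital.Build R bprod bmul1 bmulx1.

Definition null_seqs : set bprod :=
  [set a | (fun n => rnorm (a n)) @ \oo --> (0 : R)].

End BoundedProduct.

Section Fractality.
Variable R : realType.

Section Restriction.
Variables (C : nat -> unitalCstarAlgType R) (eta : nat -> nat).

Lemma seq_bounded_restr (a : bprod C) :
  seq_bounded (fun n => a (eta n) : C (eta n)).
Proof. by case: (bseqP a) => M aM; exists M => n; exact: aM. Qed.

Definition restr (a : bprod C) : bprod (fun n => C (eta n)) :=
  BProd (seq_bounded_restr a).

End Restriction.

Definition strictly_increasing (eta : nat -> nat) : Prop :=
  {homo eta : m n / (m < n)%N}.

(* W stands for its restriction to S, and Weta for its restriction to the
   image of S under restr eta; values outside of these sets are irrelevant. *)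
Definition fractal_map (C : nat -> unitalCstarAlgType R) (S : set (bprod C))
    (B : Type) (W : bprod C -> B) : Prop :=
  forall eta, strictly_increasing eta ->
    exists Weta : bprod (fun n => C (eta n)) -> B,
      forall a, S a -> W a = Weta (restr eta a).

(* the canonical map S -> S / J, a |-> a + J, an element of the quotient being
   a coset *)
Definition quotient_map (V : zmodType) (J : set V) (a : V) : set V :=
  [set a + j | j in J].

Lemma quotient_mapP (V : zmodType) (J : set V) (a b : V) :
  J 0 -> (forall x y, J x -> J y -> J (x - y)) ->
  quotient_map J a = quotient_map J b <-> J (a - b).
Proof.
move=> J0 JB.
have JN x : J x -> J (- x) by rewrite -sub0r; exact: JB.
have JD x y : J x -> J y -> J (x + y) by move=> ? /JN; rewrite -{2}(opprK y); exact: JB.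
split=> [ab|Jab].
  have : quotient_map J b a by rewrite -ab; exists 0 => //; rewrite addr0.
  by move=> [j Jj <-]; rewrite addrC addKr.
apply/seteqP; split=> _ [j Jj <-].
  by exists (a - b + j); [exact: JD | rewrite addrA [b + _]addrC subrK].
by exists (j - (a - b)); [exact: JB | rewrite opprB addrCA [a + _]addrC subrK addrC].
Qed.

Definition fractal_subalgebra (C : nat -> unitalCstarAlgType R)
    (S : set (bprod C)) : Prop :=
  cstar_subalgebra S /\ fractal_map S (quotient_map (S `&` @null_seqs R C)).

End Fractality.

(* Main.v *)
Require Import Defs.
From HB Require Import structures.
From mathcomp Require Import all_boot all_order all_algebra.
From mathcomp Require Import complex lra ring.
From mathcomp Require Import all_classical all_reals all_analysis.

(* Closedness of the restricted algebra holds for every [eta]: a contractive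
   *-morphism out of a C*-subalgebra has closed range. Spectral theory is
   avoided: for self-adjoint [b], the imaginary part of [(1 + i b / N)^N] has
   norm at most 2 once [N] is large, by the C*-identity, while its image is
   close to that of [b] when the image of [b] is small. This lifts elements of
   the range approximately with a norm bound, and the lifts are summed up as in
   the open mapping theorem.

   Fractality holds as soon as the norms of [a (eta n)] converge for every [a]
   in the algebra, since a convergent sequence vanishing along a subsequence
   tends to zero. By separability it is enough to make countably many bounded
   real sequences converge along [eta]. *)

Import Order.TTheory GRing.Theory Num.Theory.
Import numFieldNormedType.Exports.

Local Open Scope classical_set_scope.
Local Open Scope ring_scope.

(** * Norms and convergence with real values *)

Section RealNormTheory.
Context {R : realType} {V : normedModType R[i]}.
Implicit Types x y : V.

Lemma rnorm0 : rnorm (0 : V) = 0.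
Proof. by rewrite /rnorm normr0. Qed.

Lemma rnormD x y : rnorm (x + y) <= rnorm x + rnorm y.
Proof. by rewrite rnorm_leE rmorphD/= !rnormE ler_normD. Qed.

Lemma rnormN x : rnorm (- x) = rnorm x.
Proof. by rewrite /rnorm normrN. Qed.

Lemma rnormB x y : rnorm (x - y) <= rnorm x + rnorm y.
Proof. by rewrite -(rnormN y) rnormD. Qed.

Lemma rdistC x y : rnorm (x - y) = rnorm (y - x).
Proof. by rewrite -rnormN opprB. Qed.

Lemma rdist_triangle y x z : rnorm (x - z) <= rnorm (x - y) + rnorm (y - z).
Proof. by rewrite -(subrKA y) rnormD. Qed.

Lemma rnormZ (c : R[i]) x : rnorm (c *: x) = complex.Re `|c| * rnorm x.
Proof.
have := @rnormE R V (c *: x); rewrite normrZ -rnormE -Re_normcM.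
by move/(congr1 (@complex.Re R)).
Qed.

Lemma rnormZr (c : R) x : rnorm (c%:C%C *: x) = `|c| * rnorm x.
Proof. by rewrite rnormZ normc_def/= expr0n addr0 sqrtr_sqr. Qed.

Lemma rnormZi (c : R) x : rnorm ((0 +i* c)%C *: x) = `|c| * rnorm x.
Proof. by rewrite rnormZ normc_def/= expr0n add0r sqrtr_sqr. Qed.

Lemma rnorm0_eq0 x : rnorm x = 0 -> x = 0.
Proof. by move=> x0; apply/eqP; rewrite -normr_eq0 -rnormE x0. Qed.

Lemma rnorm_ball x (e : R) y : ball x e%:C%C y <-> rnorm (x - y) < e.
Proof. by rewrite -ball_normE /= -rnormE ltcR. Qed.

Lemma rnorm_closureP (S : set V) x :
  closure S x <-> forall e : R, 0 < e -> exists2 y, S y & rnorm (x - y) < e.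
Proof.
split=> [Sx e e0|Sx B /nbhs_ballP[e /= e0 eB]].
  have [|y [Sy xy]] := Sx (ball x e%:C%C); first by apply: nbhsx_ballx; rewrite ltcR.
  by exists y => //; exact/rnorm_ball.
have eE : e = (complex.Re e)%:C%C by rewrite RRe_real// gtr0_real.
have [|y Sy xy] := Sx (complex.Re e); first by rewrite -ltcR -eE.
by exists y; split => //; apply: eB; rewrite eE; exact/rnorm_ball.
Qed.

End RealNormTheory.

(** Geometrically decaying increments make [u] a Cauchy sequence; used to sum the successive
    lifts. *)
Lemma geometric_rcvg {R : realType} {V : completeNormedModType R[i]}
    (u : nat -> V) (M : R) :
  (forall n, rnorm (u n.+1 - u n) <= M / 2 ^+ n) ->
  exists l : V, forall e : R, 0 < e -> \forall n \near \oo, rnorm (l - u n) < e.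
Proof.
move=> uM.
have M0 : 0 <= M by have := uM 0%N; rewrite divr1; apply: le_trans; exact: rnorm_ge0.
(* The first factor is the partial sum 1 + 1/2 + ... + 1/2^(k-1). *)
have uD N k : rnorm (u N - u (N + k)%N) <= (2 - 2 / 2 ^+ k) * (M / 2 ^+ N).
  elim: k => [|k IH]; first by rewrite addn0 subrr rnorm0 expr0 divr1 subrr mul0r.
  apply: le_trans (rdist_triangle (u (N + k)%N) _ _) _; rewrite addnS.
  apply: le_trans (lerD IH _) _; first by rewrite rdistC; exact: uM.
  rewrite exprD exprS le_eqVlt; apply/orP; left; apply/eqP; field.
  by rewrite !expf_neq0.
have small (e : R) : 0 < e -> exists N, 2 * (M / 2 ^+ N) < e.
  move=> e0; have [N MN] : exists N : nat, 2 * M / e < N%:R.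
    exists (Num.bound (2 * M / e)); apply: archi_boundP.
    by rewrite divr_ge0 ?mulr_ge0// ltW.
  exists N; rewrite mulrA ltr_pdivrMr ?exprn_gt0//.
  rewrite ltr_pdivrMr// in MN; apply: (lt_le_trans MN).
  by rewrite mulrC ler_pM2l// -natrX ler_nat ltnW// ltn_expl.
have uN (e : R) : 0 < e -> exists N, \forall n \near \oo, rnorm (u N - u n) < e.
  move=> e0; have [N Ne] := small e e0; exists N; exists N => //= n Nn.
  rewrite -(subnKC Nn); apply: le_lt_trans (uD _ _) (le_lt_trans _ Ne).
  by rewrite ler_wpM2r ?divr_ge0 ?exprn_ge0// gerBl divr_ge0// exprn_ge0.
have /cauchy_cvgP/cvg_ex[l /cvgrPdist_lt ul] : cauchy (u @ \oo).
  apply/cauchyP => e e0.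
  have eE : e = (complex.Re e)%:C%C by rewrite RRe_real// gtr0_real.
  have [|N Ne] := uN (complex.Re e); first by rewrite -ltcR -eE.
  exists (u N); rewrite eE; apply: filterS Ne => n /=.
  by move=> h; apply/rnorm_ball.
exists l => e e0; have := ul e%:C%C; rewrite ltcR => /(_ e0).
by apply: filterS => n /=; rewrite -rnormE ltcR.
Qed.

(** * C*-norm estimates for powers of 1 + z *)

Section CStarNorm.
Context {R : realType} {A : cstarAlgType R}.
Implicit Types x y : A.

Lemma ler_rnormM x y : rnorm (x *c y) <= rnorm x * rnorm y.
Proof. by rewrite rnorm_leE rmorphM/= !rnormE ler_cnormM. Qed.

Lemma rnorm_star x : rnorm (star x) = rnorm x.
Proof. by rewrite /rnorm norm_star. Qed.

Lemma rnorm_cstar x : rnorm (star x *c x) = rnorm x ^+ 2.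
Proof.
by apply: complexI; rewrite rnormE cstar_identity -rnormE rmorphXn.
Qed.

Lemma starB : {morph (star : A -> A) : x y / x - y}.
Proof. by move=> x y; rewrite starD -scaleN1r starZ rmorphN1 scaleN1r. Qed.

(* [circ_pow z n] is [(1 + z)^n - 1], written so that it makes sense without a
   unit and stays in every subalgebra containing [z]. *)
Fixpoint circ_pow (z : A) (n : nat) : A :=
  if n is m.+1 then circ_pow z m + z + circ_pow z m *c z else 0.

Lemma rnorm_circ_pow (z : A) n :
  rnorm (circ_pow z n) <= (1 + rnorm z) ^+ n - 1.
Proof.
elim: n => [|n IH] /=; first by rewrite rnorm0 expr0 subrr.
have z0 := rnorm_ge0 z.
apply: le_trans (rnormD _ _) _; apply: le_trans (lerD (rnormD _ _) (ler_rnormM _ _)) _.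
by rewrite exprSr; nra.
Qed.

(** The terms of order at least two have nonnegative binomial coefficients, so their sum is
    dominated by the same sum for the scalar [rnorm z]. *)
Lemma rnorm_circ_powB (z : A) n :
  rnorm (circ_pow z n - z *+ n) <= (1 + rnorm z) ^+ n - 1 - n%:R * rnorm z.
Proof.
elim: n => [|n IH] /=; first by rewrite subrr rnorm0 expr0 mul0r subrr subr0.
have z0 := rnorm_ge0 z.
have -> : circ_pow z n + z + circ_pow z n *c z - z *+ n.+1 =
    (circ_pow z n - z *+ n) + circ_pow z n *c z.
  by rewrite addrAC mulrS addrKA.
apply: le_trans (rnormD _ _) _; apply: le_trans (lerD IH (ler_rnormM _ _)) _.
have := ler_wpM2r z0 (rnorm_circ_pow z n); rewrite exprSr -natr1 !mulrBl mulrDl mulrDr.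
by lra.
Qed.

Lemma circ_pow_mem (S : set A) (z : A) n :
  cstar_subalgebra S -> S z -> S (circ_pow z n).
Proof.
move=> hS Sz; elim: n => [|n IH] /=; first exact: csub0 hS.
by do !apply: (csubD hS) => //; exact: (csubM hS).
Qed.

End CStarNorm.

Lemma star_cone {R : realType} {A : unitalCstarAlgType R} : star (cone : A) = cone.
Proof. by rewrite -[LHS]cmulx1 -{2}[cone]starK -starM cmulx1 starK. Qed.

(** With a unit at hand, [cone + circ_pow z n] is the true power of [cone + z], and the norm is
    submultiplicative. *)
Lemma rnorm_cone_circ_pow {R : realType} {A : unitalCstarAlgType R} (z : A) n :
  rnorm (cone + circ_pow z n) <= rnorm (cone + z) ^+ n.
Proof.
elim: n => [|n IH] /=.
  by rewrite addr0 expr0 rnorm_leE norm_cone_le1.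
have -> : cone + (circ_pow z n + z + circ_pow z n *c z) =
    (cone + circ_pow z n) *c (cone + z).
  by rewrite cmulDr cmulx1 cmulDl cmul1x !addrA.
apply: le_trans (ler_rnormM _ _) _.
by rewrite exprSr ler_wpM2r ?rnorm_ge0.
Qed.

(* [1 + z] is a multiple of a unitary for skew-adjoint [z]: its norm exceeds 1
   only to second order. *)
Lemma rnorm_cone_skew {R : realType} {A : unitalCstarAlgType R} (z : A) :
  star z = - z -> rnorm (cone + z) ^+ 2 <= 1 + rnorm z ^+ 2.
Proof.
move=> zN; rewrite -rnorm_cstar starD zN.
have cN (x y : A) : (- x) *c y = - (x *c y).
  by rewrite -scaleN1r -cscalerAl scaleN1r.
rewrite star_cone cmulDl cmul1x cN cmulDr cmulx1 opprD addrA addrK.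
apply: le_trans (rnormB _ _) _; apply: lerD; first by rewrite rnorm_leE norm_cone_le1.
by rewrite expr2 ler_rnormM.
Qed.

(** By Bernoulli, (1 + s)^n (1 - n s) <= (1 + s)^n (1 - s)^n = (1 - s^2)^n <= 1. *)
Lemma expr1D_le {R : realType} (s : R) n : 0 <= s -> n%:R * s < 1 ->
  (1 + s) ^+ n <= (1 - n%:R * s)^-1.
Proof.
move=> s0 ns1.
have bern k : k%:R * s <= 1 -> 1 - k%:R * s <= (1 - s) ^+ k.
  elim: k => [|k IH]; first by rewrite mul0r subr0.
  rewrite -natr1 mulrDl mul1r exprSr => ks.
  have k0 : 0 <= k%:R :> R by [].
  have /IH : k%:R * s <= 1 by lra.
  case: k {IH} ks k0 => [|k] ks k0; first by rewrite expr0; lra.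
  rewrite -natr1 in ks k0 *; have := ler0n R k => k0' h; nra.
rewrite -(@ler_pM2r _ (1 - n%:R * s)) ?subr_gt0// mulVf ?lt0r_neq0 ?subr_gt0//.
have [->|n0] := eqVneq n 0%N; first by rewrite expr0 mul0r; lra.
have n1 : 1 <= n%:R :> R by rewrite ler1n lt0n.
have p0 : 0 <= (1 + s) ^+ n by rewrite exprn_ge0//; lra.
apply: le_trans (ler_wpM2l p0 (bern n (ltW ns1))) _.
by rewrite -exprMn exprn_ile1//; nra.
Qed.

(** * Closed range of contractive *-morphisms *)

Section ContractiveStarMorphism.
Context {R : realType} {A : unitalCstarAlgType R} {B : cstarAlgType R}.
Variables (phi : {linear A -> B}) (S : set A).
Hypothesis phiM : {morph phi : x y / x *c y}.
Hypothesis phi_star : {morph phi : x / star x}.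
Hypothesis phi_le : forall x, rnorm (phi x) <= rnorm x.
Hypothesis hS : cstar_subalgebra S.

Lemma csubB x y : S x -> S y -> S (x - y).
Proof. by move=> Sx Sy; rewrite -scaleN1r; apply: (csubD hS) => //; exact: csubZ. Qed.

Lemma circ_pow_morph z n : phi (circ_pow z n) = circ_pow (phi z) n.
Proof. by elim: n => [|n IH] /=; rewrite ?linear0// !linearD phiM IH. Qed.

(* With [h] the rescaling of [b] for which [phi h] has norm 1/9, [y] is a
   rescaling of the imaginary part of [(1 + i h / N)^N], a substitute for
   [sin h]: its norm is bounded by the C*-identity, while [sin t] is close to
   [t] for small [t]. *)
Lemma selfadjoint_approx_lift b : S b -> star b = b ->
  exists y, [/\ S y, rnorm y <= 18 * rnorm (phi b) &
    rnorm (phi b - phi y) <= rnorm (phi b) / 8].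
Proof.
move=> Sb bb; set r := rnorm (phi b).
have r0 : 0 <= r by exact: rnorm_ge0.
have [rE|rn0] := eqVneq r 0.
  exists 0; split; first exact: csub0 hS.
    by rewrite rnorm0 rE mulr0.
  by rewrite linear0 subr0 -/r rE mul0r.
have rp : 0 < r by rewrite lt0r rn0.
set t := (9 * r)^-1; set H := t * rnorm b.
(* This size of [N0] gives [N0 * rnorm z ^+ 2 = H ^+ 2 / N0 <= 1 / 2] below. *)
have [N0 HN] : exists N : nat, 2 * H ^+ 2 < N%:R.
  exists (Num.bound (2 * H ^+ 2)); apply: archi_boundP.
  by rewrite mulr_ge0// sqr_ge0.
have t0 : 0 < t by rewrite invr_gt0 mulr_gt0.
have Np : 0 < N0%:R :> R by rewrite (le_lt_trans _ HN)// mulr_ge0// sqr_ge0.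
pose v := (0 +i* t)%C *: b.
pose z := (0 +i* (t / N0%:R))%C *: b.
have Sz : S z by exact: csubZ.
have starI (x : R) : star ((0 +i* x)%C *: b) = - ((0 +i* x)%C *: b).
  by rewrite starZ bb -scaleNr; congr (_ *: _); apply/eqP; rewrite eq_complex /= oppr0 !eqxx.
have zN : z *+ N0 = v.
  rewrite /z /v -scaler_nat scalerA; congr (_ *: _).
  rewrite -(rmorph_nat (real_complex R)).
  apply/eqP; rewrite eq_complex /=; apply/andP; split; apply/eqP; field;
    by rewrite gt_eqF.
set w := circ_pow z N0.
have Sw : S w by exact: circ_pow_mem.
have zH : N0%:R * rnorm z ^+ 2 <= 1 / 2.
  rewrite rnormZi ger0_norm; last by rewrite divr_ge0// ltW.
  rewrite mulrAC -/H; have -> : N0%:R * (H / N0%:R) ^+ 2 = H ^+ 2 / N0%:R.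
    by field; rewrite gt_eqF.
  by rewrite ler_pdivrMr//; lra.
(* The square of the norm is at most (1 + |z|^2)^N0 <= 1 / (1 - 1/2) = 2. *)
have w2 : rnorm (cone + w) <= 2.
  rewrite -(@ler_pXn2r _ 2)// ?nnegrE ?rnorm_ge0//.
  apply: (@le_trans _ _ ((1 + rnorm z ^+ 2) ^+ N0)).
    apply: (@le_trans _ _ ((rnorm (cone + z) ^+ N0) ^+ 2)).
      by rewrite lerXn2r ?nnegrE ?exprn_ge0 ?rnorm_ge0// rnorm_cone_circ_pow.
    rewrite -exprM mulnC exprM lerXn2r ?nnegrE ?sqr_ge0//.
      by rewrite addr_ge0// sqr_ge0.
    by apply: rnorm_cone_skew; exact: starI.
  apply: le_trans (expr1D_le _ _ _ _) _; [exact: sqr_ge0 | lra |].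
  apply: (@le_trans _ _ 2); last by rewrite expr2; lra.
  by rewrite -[leRHS]invrK lef_pV2 ?posrE ?invr_gt0//; lra.
set E := phi w - phi v.
(* As N0 |phi z| = 1/9, the remainder is at most 9/8 - 1 - 1/9 = 1/72. *)
have Eb : rnorm E <= 1 / 72.
  rewrite /E -zN /w circ_pow_morph linearMn.
  apply: le_trans (rnorm_circ_powB _ _) _.
  have s0 := rnorm_ge0 (phi z).
  have sE : N0%:R * rnorm (phi z) = 1 / 9.
    rewrite /z linearZ rnormZi -/r ger0_norm; last by rewrite divr_ge0// ltW.
    by rewrite /t; field; rewrite (gt_eqF Np).
  have le := @expr1D_le R (rnorm (phi z)) N0 s0.
  have lt1 : N0%:R * rnorm (phi z) < 1 by rewrite sE; lra.
  apply: le_trans (lerB (lerB (le lt1) (lexx _)) (lexx _)) _.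
  have -> : (1 - N0%:R * rnorm (phi z))^-1 = 9 / 8 by rewrite sE; field.
  by rewrite sE; lra.
(* [c] is 1 / (2 i t), so that [c *: (v - star v)] gives back [b]. The bounds become (9 r / 2) * 4 =
   18 r and (9 r / 2) / 36 = r / 8. *)
pose c : R[i] := (0 +i* (- (9 * r / 2)))%C.
exists (c *: (w - star w)); split.
- by apply: (csubZ hS); apply: csubB => //; exact: csub_star.
(* The unit cancels in the imaginary part, so it may lie outside [S] and still serve in the
   estimate. *)
- have -> : w - star w = (cone + w) - star (cone + w).
    by rewrite starD star_cone opprD addrACA subrr add0r.
  rewrite rnormZi normrN ger0_norm; last by rewrite divr_ge0// mulr_ge0.
  have := rnormB (cone + w) (star (cone + w)); rewrite rnorm_star => h.
  have h4 : rnorm (cone + w - star (cone + w)) <= 4 by lra.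
  have r9 : 0 <= 9 * r / 2 by lra.
  by apply: le_trans (ler_wpM2l r9 h4) _; lra.
have vE : c *: (v - star v) = b.
  rewrite /v starI opprK -scalerDl scalerA -[RHS]scale1r; congr (_ *: _).
  by apply/eqP; rewrite eq_complex /=; apply/andP; split; apply/eqP; rewrite /t; field.
have -> : phi b - phi (c *: (w - star w)) = - (c *: (E - star E)).
  rewrite -{1}vE -scalerN !linearZ/= -scalerDr; congr (_ *: _).
  rewrite !linearB /= !phi_star /E starB.
  by rewrite !opprB !opprK [LHS]addrACA [- phi w + _]addrC [- star _ + _]addrC.
rewrite rnormN rnormZi normrN ger0_norm; last by rewrite divr_ge0// mulr_ge0.
have h := rnormB E (star E); rewrite rnorm_star in h.
have r9 : 0 <= 9 * r / 2 by lra.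
have h4 : rnorm (E - star E) <= 1/36 by lra.
by apply: le_trans (ler_wpM2l r9 h4) _; lra.
Qed.

(** Split [a] as h + i k with [h], [k] self-adjoint and lift both; the constants of the self-adjoint
    case double. *)
Lemma approx_lift a : S a ->
  exists y, [/\ S y, rnorm y <= 36 * rnorm (phi a) &
    rnorm (phi a - phi y) <= rnorm (phi a) / 4].
Proof.
move=> Sa.
pose h := (1 / 2)%:C%C *: (a + star a); pose k := (0 +i* (- (1 / 2)))%C *: (a - star a).
have Sh : S h by apply: (csubZ hS); apply: (csubD hS) => //; exact: csub_star.
have Sk : S k by apply: (csubZ hS); apply: csubB => //; exact: csub_star.
have sh : star h = h.
  rewrite /h starZ starD starK [star a + a]addrC; congr (_ *: _).
  by apply/eqP; rewrite eq_complex /= oppr0 !eqxx.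
have sk : star k = k.
  rewrite /k starZ starB starK -(opprB a) scalerN -scaleNr; congr (_ *: _).
  by apply/eqP; rewrite eq_complex /= oppr0 opprK !eqxx.
have aE : a = h + (0 +i* 1)%C *: k.
  rewrite /h /k scalerA; set c := (0 +i* 1)%C * _; have -> : c = (1 / 2)%:C%C.
    by apply/eqP; rewrite eq_complex /=; apply/andP; split; apply/eqP; field.
  rewrite -scalerDr addrACA subrr addr0 -mulr2n -(scaler_nat 2 a) scalerA.
  rewrite -[LHS]scale1r; congr (_ *: _); rewrite -(rmorph_nat (real_complex R)).
  by apply/eqP; rewrite eq_complex /=; apply/andP; split; apply/eqP; field.
have half x : rnorm (phi x + star (phi x)) <= 2 * rnorm (phi x) /\
    rnorm (phi x - star (phi x)) <= 2 * rnorm (phi x).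
  have := rnormD (phi x) (star (phi x)); have := rnormB (phi x) (star (phi x)).
  by rewrite rnorm_star => *; split; lra.
have [hp hm] := half a.
have hh : rnorm (phi h) <= rnorm (phi a).
  rewrite /h linearZ linearD rnormZr /= phi_star ger0_norm ?divr_ge0//; lra.
have kk : rnorm (phi k) <= rnorm (phi a).
  rewrite /k linearZ linearB rnormZi /= phi_star normrN ger0_norm ?divr_ge0//; lra.
have [y1 [Sy1 ny1 dy1]] := selfadjoint_approx_lift h Sh sh.
have [y2 [Sy2 ny2 dy2]] := selfadjoint_approx_lift k Sk sk.
clearbody h k.
exists (y1 + (0 +i* 1)%C *: y2); split.
- by apply: (csubD hS) => //; exact: (csubZ hS).
- apply: le_trans (rnormD _ _) _; rewrite rnormZi normr1; lra.
- rewrite {1}aE !linearD !linearZ /= addrACA -scalerDr.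
  by apply: le_trans (rnormD _ _) _; rewrite rnormZi normr1; lra.
Qed.

(* The successive-approximation argument of the open mapping theorem, applied
   to the approximate lifts. *)
Lemma closed_image_star_morphism : closed (phi @` S).
Proof.
move=> y /rnorm_closureP cly.
(* Since [y] is only in the closure, it is first replaced by some [phi a] within e/8. Then |phi (a -
   s)| <= 9e/8, the correction has norm at most 36 * 9e/8 <= 45e, and the new error is at most e/8 +
   9e/32 <= e/2. *)
have step (s : A) (e : R) : S s -> 0 < e -> rnorm (y - phi s) <= e ->
    exists s', [/\ S s', rnorm (y - phi s') <= e / 2 & rnorm (s' - s) <= 45 * e].
  move=> Ss e0 se; have e8 : 0 < e / 8 by lra.
  have [_ [a Sa <-] ya] := cly _ e8.
  have [b [Sb nb db]] := approx_lift (a - s) (csubB _ _ Sa Ss).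
  have nas : rnorm (phi (a - s)) <= 9 * e / 8.
    rewrite linearB; apply: le_trans (rdist_triangle y _ _) _.
    by rewrite (rdistC (phi a)); lra.
  exists (s + b); split; first exact: (csubD hS).
    rewrite linearD; have -> : y - (phi s + phi b) = (y - phi a) + (phi (a - s) - phi b).
      by rewrite linearB addrA subrKA opprD addrA.
    by apply: le_trans (rnormD _ _) _; lra.
  by rewrite addrC addKr; lra.
have [_ [s0 Ss0 _] _] := cly _ ltr01.
(* The summand 1 keeps [e0] positive even when [phi s0 = y]. *)
pose e0 := rnorm (y - phi s0) + 1.
have e00 : 0 < e0 by rewrite ltr_wpDl// rnorm_ge0.
have en n : 0 < e0 / 2 ^+ n by rewrite divr_gt0// exprn_gt0.
pose good n s := S s /\ rnorm (y - phi s) <= e0 / 2 ^+ n.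
(* Stated for every pair, with the dummy value 0 when [s] is not good, so that a choice function
   exists. *)
have next n s : exists s', good n s ->
    good n.+1 s' /\ rnorm (s' - s) <= 45 * e0 / 2 ^+ n.
  have [[Ss ys]|ng] := pselect (good n s); last by exists 0.
  have [s' [Ss' ys' ss']] := step s _ Ss (en n) ys.
  exists s' => _; split; last by rewrite -mulrA.
  by split=> //; rewrite exprS invfM mulrCA mulrC.
have /choice[f fP] : forall ns : nat * A, exists s', good ns.1 ns.2 ->
    good ns.1.+1 s' /\ rnorm (s' - ns.2) <= 45 * e0 / 2 ^+ ns.1.
  by case=> n s; exact: next.
pose u := fix u n := if n is m.+1 then f (m, u m) else s0.
have gu n : good n (u n).
  elim: n => [|n IH]; first by split=> //=; rewrite expr0 divr1 lerDl.
  by case: (fP (n, u n) IH).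
have [l ul] := geometric_rcvg u (45 * e0) (fun n => (fP (n, u n) (gu n)).2).
have near_small (e : R) : 0 < e -> \forall n \near \oo, e0 / 2 ^+ n < e.
  move=> ep; near=> n; rewrite ltr_pdivrMr ?exprn_gt0//.
  have : e0 / e < n%:R by near: n; exact: nbhs_infty_gtr.
  rewrite ltr_pdivrMr// mulrC => /lt_le_trans; apply.
  by rewrite ler_pM2l// -natrX ler_nat ltnW// ltn_expl.
exists l.
  apply: (csub_closed hS); apply/rnorm_closureP => e ep.
  have [n un] := filter_ex (ul e ep).
  by exists (u n) => //; case: (gu n).
apply/esym/eqP; rewrite -subr_eq0; apply/eqP/rnorm0_eq0/eqP.
rewrite eq_le rnorm_ge0 andbT; apply/ler_addgt0Pl => e ep; rewrite addr0.
have e2 : 0 < e / 2 by lra.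
have [n [ln sn]] := filter_ex (filterI (ul _ e2) (near_small _ e2)).
apply: le_trans (rdist_triangle (phi (u n)) _ _) _.
rewrite (rdistC (phi (u n))) -linearB.
by have := phi_le (l - u n); have := (gu n).2; lra.
Unshelve. all: by end_near.
Qed.

Lemma cstar_subalgebra_image : cstar_subalgebra (phi @` S).
Proof.
split; last exact: closed_image_star_morphism.
- by exists 0; [exact: csub0 hS | rewrite linear0].
- move=> _ _ [x Sx <-] [y Sy <-].
  by exists (x + y); [exact: (csubD hS) | rewrite linearD].
- by move=> c _ [x Sx <-]; exists (c *: x); [exact: (csubZ hS) | rewrite linearZ].
- move=> _ _ [x Sx <-] [y Sy <-].
  by exists (x *c y); [exact: (csubM hS) | rewrite phiM].
- by move=> _ [x Sx <-]; exists (star x); [exact: (csub_star hS) | rewrite phi_star].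
Qed.

End ContractiveStarMorphism.

(** * Restriction as a contractive *-morphism *)

Lemma restr_linear {R : realType} (C : nat -> unitalCstarAlgType R) (eta : nat -> nat) :
  linear (restr eta : bprod C -> bprod (fun n => C (eta n))).
Proof. by move=> c a b; exact: bprodP. Qed.

HB.instance Definition _ (R : realType) (C : nat -> unitalCstarAlgType R) eta :=
  GRing.isLinear.Build R[i] (bprod C) (bprod (fun n => C (eta n))) _ (restr eta)
    (restr_linear C eta).

Lemma cstar_subalgebra_restr {R : realType} {C : nat -> unitalCstarAlgType R}
    (A : set (bprod C)) (eta : nat -> nat) :
  cstar_subalgebra A -> cstar_subalgebra (restr eta @` A).
Proof.
apply: cstar_subalgebra_image => [a b|a|a]; try exact: bprodP.
by apply: supnorm_le => n; exact: (rnorm_le_supnorm a).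
Qed.

(** * Subsequences with convergent norms *)

Lemma strictly_increasing_ge (eta : nat -> nat) n : strictly_increasing eta -> (n <= eta n)%N.
Proof. by move=> h; elim: n => // n IH; apply: leq_ltn_trans IH (h _ _ _). Qed.

(* An ultrafilter finer than the cofinite one supplies all the limits at once. *)
Lemma common_convergent_subsequence {R : realType} (u : nat -> nat -> R) :
  (forall k, exists M, forall n, `|u k n| <= M) ->
  exists eta p, strictly_increasing eta /\
    forall k, (fun m => u k (eta m)) @ \oo --> (p k : R).
Proof.
move=> ub; have [G [GU coG]] := @ultraFilterLemma nat \oo _.
have /choice[p Gp] : forall k, exists p : R, u k @ G --> p.
  move=> k; have [M uM] := ub k.
  have GM : (u k @ G) `[- M, M]%classic.
    by apply: (@filterS _ G _ setT) => [n _ /=|]; [rewrite in_itv/= -ler_norml | exact: filterT].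
  have [l [_ cl]] := @segment_compact R (- M) M (u k @ G) _ GM.
  (* For an ultrafilter a cluster point is a limit: otherwise the complement of some neighbourhood
     would be in the image filter and miss it. *)
  exists l => B /= Bl; case: (in_ultra_setVsetC (u k @^-1` B) GU) => // GB.
  by have [x []] := cl (~` B) B GB Bl.
(* Diagonal choice: finitely many closeness conditions and a tail all belong to [G], hence share a
   point. *)
have pick m N : exists n, (N < n)%N /\
    forall k, (k <= m)%N -> `|p k - u k n| < m.+1%:R^-1.
  have Gm j : G [set n | forall k, (k < j)%N -> `|p k - u k n| < m.+1%:R^-1].
    elim: j => [|j IH]; first by apply: (@filterS _ G _ setT) => [n _ k //|]; exact: filterT.
    have /cvgrPdist_lt/(_ m.+1%:R^-1) := Gp j; rewrite invr_gt0 ltr0n => /(_ isT) Gj.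
    apply: filterS2 IH Gj => n nk nj k.
    by rewrite ltnS leq_eqVlt => /predU1P[->//|]; exact: nk.
  have GN : G [set n | (N < n)%N] by apply: coG; exists N.+1.
  by have [n [Nn nk]] := filter_ex (filterI GN (Gm m.+1)); exists n.
have /choice[f fP] : forall mN : nat * nat, exists n, (mN.2 < n)%N /\
    forall k, (k <= mN.1)%N -> `|p k - u k n| < mN.1.+1%:R^-1.
  by case=> m N; exact: pick.
pose eta := fix eta n := f (n, if n is m.+1 then eta m else 0%N).
have etaS n : (eta n < eta n.+1)%N by exact: (fP (n.+1, eta n)).1.
have pu m k : (k <= m)%N -> `|p k - u k (eta m)| < m.+1%:R^-1.
  by case: m => [|m] km; [exact: (fP (0, 0)%N).2 | exact: (fP (m.+1, eta m)).2].
exists eta, p; split; first exact: (homo_ltn ltn_trans).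
move=> k; apply/cvgrPdist_lt => e e0; near=> m.
have km : (k <= m)%N by near: m; exists k.
apply: lt_trans (pu m k km) _; rewrite invf_plt ?posrE//.
apply: lt_trans (_ : m%:R < _); last by rewrite ltr_nat.
by near: m; exact: nbhs_infty_gtr.
Unshelve. all: by end_near.
Qed.

(** Convergence is stated up to each [e], so the limit for a nearby element of the dense set can
    serve as [p]. *)
Lemma separable_norm_convergent_subsequence {R : realType}
    {C : nat -> unitalCstarAlgType R} (A : set (bprod C)) :
  separable_set A ->
  exists eta : nat -> nat, strictly_increasing eta /\
    forall a, A a -> forall e : R, 0 < e -> exists p : R,
      \forall m \near \oo, `|p - rnorm (a (eta m))| < e.
Proof.
move=> [D [/countable_injP[f finj] DA AD]].
(* An enumeration of [D]; indices that code no element get 0, whose norms are bounded as well. *)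
pose d k : bprod C := xget 0 [set x | D x /\ f x = k].
have dD x : D x -> d (f x) = x.
  move=> Dx; rewrite /d; case: xgetP => [y _ [Dy fy]|/(_ x)[]//].
  by apply: finj; rewrite ?inE.
have [k|eta [p [eta_incr pk]]] :=
    @common_convergent_subsequence R (fun k n => rnorm (d k n)).
  exists (supnorm (d k)) => n.
  by rewrite ger0_norm ?rnorm_ge0// rnorm_le_supnorm.
exists eta; split=> // a /AD/rnorm_closureP ad e e0.
have e2 : 0 < e / 2 by rewrite divr_gt0.
have [x Dx ax] := ad _ e2; exists (p (f x)).
have /cvgrPdist_lt/(_ _ e2) := pk (f x); rewrite dD//.
apply: filterS => m pm.
rewrite (splitr e) (le_lt_trans (ler_distD (rnorm (x (eta m))) _ _))// ltrD//.
apply: le_lt_trans ax.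
apply: le_trans (rnorm_le_supnorm (a - x) (eta m)) => /=.
have := rnormD (x (eta m)) (a (eta m) - x (eta m)).
have := rnormD (a (eta m)) (x (eta m) - a (eta m)).
rewrite !subrKC (rdistC (x (eta m))) => h1 h2.
by rewrite ler_norml; lra.
Qed.

(** * Fractality of the restricted algebra *)

Theorem theorem6 (R : realType) (C : nat -> unitalCstarAlgType R)
    (A : set (bprod C)) (hA : cstar_subalgebra A) (sepA : separable_set A) :
  exists eta : nat -> nat,
    strictly_increasing eta /\ fractal_subalgebra (restr eta @` A).
Proof.
have [eta [eta_incr etaP]] := separable_norm_convergent_subsequence A sepA.
exists eta; split=> //.
have hAeta := cstar_subalgebra_restr A eta hA; split=> // mu mu_incr.
set S := restr eta @` A in hAeta *.
set J := S `&` @null_seqs R _.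
(* The factor map sends [y] to the coset of a chosen preimage. It remains to see that two preimages
   differ by a null sequence. *)
pose lift y := xget 0 [set a | S a /\ restr mu a = y].
exists (fun y => quotient_map J (lift y)) => a Sa.
have [Sl la] : S (lift (restr mu a)) /\ restr mu (lift (restr mu a)) = restr mu a.
  by rewrite /lift; case: xgetP => [y _ //|/(_ a)[]].
apply/quotient_mapP.
- split; first exact: csub0 hAeta.
  by apply: cvg_near_cst; apply: nearW => n; exact: rnorm0.
- move=> x y [Sx Nx] [Sy Ny]; split; first exact: (csubB _ hAeta).
  apply: (@squeeze_cvgr _ _ _ _ (fun=> 0) (fun n => rnorm (x n) + rnorm (y n))).
  + by near=> n; rewrite rnorm_ge0 rnormB.
  + exact: cvg_cst.
  + by rewrite -(addr0 0); exact: cvgD.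
have Sx : S (a - lift (restr mu a)) by exact: (csubB _ hAeta).
split=> //; move: Sx; set x := a - _ => Sx.
have x0 j : x (mu j) = 0.
  have := congr1 (fun b : bprod _ => b j) la => /= ->.
  by rewrite subrr.
have [b Ab bx] := Sx; apply/cvgrPdist_lt => e e0.
have e2 : 0 < e / 2 by rewrite divr_gt0.
have [p pb] := etaP b Ab _ e2.
(* The norms along [eta] stay within e/2 of [p] from [N] on, and at the index [mu N >= N] the norm
   is 0. *)
have pe : `|p| < e / 2.
  case: pb => N _ pN; have /= := pN (mu N) (strictly_increasing_ge mu N mu_incr).
  by rewrite -[b (eta (mu N))]/(restr eta b (mu N)) bx x0 rnorm0 subr0.
apply: filterS pb => m; rewrite -[b (eta m)]/(restr eta b m) bx => pm.
rewrite sub0r normrN (splitr e) -[rnorm _](subrK p).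
by rewrite (le_lt_trans (ler_normD _ _))// ltrD// distrC.
Unshelve. all: by end_near.
Qed.
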